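(* Let $k=4$, $\alpha\in(0,1)$, $\sigma\geqslant0$, $\tau>0$, and let $q_j^k$, $j\geqslant0$, be the real numbers defined in the context. Then for any positive integer $N$ and any $v^1,\dots,v^N\in H$, $$\sum_{n=1}^N\Big(\sum_{j=0}^{n-1}q_j^k\,v^{n-j},\,v^n\Big)\geqslant 0$$ (if the scalars are complex, the left-hand side is replaced by its real part).
   Context: $(H,(\cdot,\cdot))$ is a Hilbert space. With $k=4$, the real numbers $g_j^k$ are defined by the power series expansion at $\zeta=0$ $$\Big(\sum_{j=1}^{k}\frac1j\,(1-e^{-\sigma\tau}\zeta)^j\Big)^\alpha=\sum_{j=0}^\infty g_j^k\,\zeta^j,$$ where the branch of the power is the one that is positive at $\zeta=0$, and $$q_j^k=\sum_{m=0}^j\frac1{2^m}\,e^{-\sigma m\tau}\,g_{j-m}^k ,\qquad j\geqslant 0.$$ Equivalently, $\sum_{j\ge0}q_j^k\zeta^j$ is the power series at $\zeta=0$ of the function $\Big(\sum_{j=1}^{4}\frac1j\,(1-e^{-\sigma\tau}\zeta)^j\Big)^\alpha$ divided by $1-\frac12e^{-\sigma\tau}\zeta$. *)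

(* Defs.v *)
From HB Require Import structures.
From mathcomp Require Import all_boot all_order all_algebra.
From mathcomp Require Import complex.
From mathcomp Require Import all_classical all_reals all_analysis.
Set Implicit Arguments.
Unset Strict Implicit.
Unset Printing Implicit Defensive.
Import Order.TTheory GRing.Theory Num.Theory.
Import numFieldNormedType.Exports.
Local Open Scope classical_set_scope.
Local Open Scope ring_scope.

Definition bdf_symbol (R : realType) (k : nat) (sigma tau z : R) : R :=
  \sum_(1 <= j < k.+1) j%:R^-1 * (1 - expR (- (sigma * tau)) * z) ^+ j.

(* For real z near 0, bdf_symbol k sigma tau z is positive when k > 0, so powR
   is there the branch of the power that is positive at 0.  Convergence on a
   real neighbourhood of 0 determines the coefficients g uniquely. *)
Definition is_g_coef (R : realType) (k : nat) (alpha sigma tau : R)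
    (g : R^nat) : Prop :=
  \forall z \near (0 : R),
    pseries g z @ \oo --> bdf_symbol k sigma tau z `^ alpha.

Definition q_coef (R : realType) (sigma tau : R) (g : R^nat) (j : nat) : R :=
  \sum_(0 <= m < j.+1) (2 ^+ m)^-1 * expR (- (sigma * m%:R * tau)) * g (j - m)%N.

(* A Hilbert space is a complete normed module whose norm comes from a dot
   product; theta is idfun for real scalars and conjC for complex ones.
   The form is linear in its first argument. *)
Definition dot_induces_norm (K : numFieldType) (H : normedModType K)
    (theta : K -> K) (dot : {dot H for theta}) : Prop :=
  forall u : H, `|u| ^+ 2 = dot u u.

(* Main.v *)
Require Import Defs.
From HB Require Import structures.
From mathcomp Require Import all_boot all_order all_algebra.
From mathcomp Require Import complex.
From mathcomp Require Import all_classical all_reals all_analysis.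
From mathcomp Require Import zify ring lra.
Set Implicit Arguments.
Unset Strict Implicit.
Unset Printing Implicit Defensive.
Import Order.TTheory GRing.Theory Num.Theory.
Import numFieldNormedType.Exports.
Local Open Scope classical_set_scope.
Local Open Scope ring_scope.

(* Let d be the symbol of the four-step backward differentiation formula,
   normalised by d(0) = 1, and m(z) = 1 - z / 2.  Call a power series f passive
   if the form sum_n (f * x)_n x_n is nonnegative, * being the convolution.
   Passive series are closed under sums and inverses, hence under the
   arithmetic-harmonic mean iteration, which converges X-adically to the square
   root: if f and g are passive and f(0) = g(0) = 1, so is (f g)^(1/2).  As
   1 / m and d / m are passive, so is d^a / m for dyadic a in [0, 1], and then
   for all a in [0, 1] because the coefficients of d^a are polynomials in a.
   The damping e^(-sigma tau) is absorbed by a summation by parts, and scalar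
   positivity passes to a Hilbert space by diagonalising Gram matrices. *)

(** * Passivity of truncated power series *)

Section TruncatedSeries.
Variable R : realFieldType.
Implicit Types (p q r f g x y : {poly R}) (N : nat).

Lemma dvdXnP N p : reflect (forall i, (i < N)%N -> p`_i = 0) ('X^N %| p).
Proof.
apply: (iffP idP) => [/dvdpP[q ->] i iN | p0].
  by rewrite coefMXn iN.
rewrite -(poly_take_drop N p) (_ : take_poly N p = 0) ?add0r ?dvdp_mull//.
by apply/polyP => i; rewrite coef_take_poly coef0; case: ifP => // /p0.
Qed.

Lemma eqmodXn_coef N p q i : 'X^N %| p - q -> (i < N)%N -> p`_i = q`_i.
Proof. by move=> /dvdXnP pq /pq /eqP; rewrite coefB subr_eq0 => /eqP. Qed.

Lemma inverse_modXn N p : p`_0 = 1 -> exists q, 'X^N %| p * q - 1.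
Proof.
move=> p0; elim: N => [|N [q /dvdpP[r pq]]].
  by exists 0; rewrite expr0 dvd1p.
exists (q - r`_0 *: 'X^N).
have -> : p * (q - r`_0 *: 'X^N) - 1 = (r - r`_0 *: p) * 'X^N.
  by rewrite mulrBl -pq -!scalerAl mulrBr -scalerAr addrAC.
rewrite exprS dvdp_mul//.
by apply/(@dvdXnP 1) => -[|//] _; rewrite coefB coefZ p0 mulr1 subrr.
Qed.

Lemma eqmodXn_mulI N p x y :
  p`_0 = 1 -> 'X^N %| p * (x - y) -> 'X^N %| x - y.
Proof.
move=> /(inverse_modXn N)[q pq1] pxy.
have -> : x - y = q * (p * (x - y)) - (p * q - 1) * (x - y) by ring.
by apply: dvdp_sub; [exact: dvdp_mull | exact: dvdp_mulr].
Qed.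

(** Only coefficients of index below [N] enter: the lower triangular Toeplitz matrix of [p], of size
    [N], has a positive semidefinite symmetric part. *)
Definition passive N p :=
  forall x, 0 <= \sum_(n < N) (p * x)`_n * x`_n.

Lemma passive_congr N p q : 'X^N %| p - q -> passive N p -> passive N q.
Proof.
move=> pq Pp x; rewrite (eq_bigr (fun n : 'I_N => (p * x)`_n * x`_n))//.
move=> n _; rewrite (@eqmodXn_coef N (p * x) (q * x))//.
by rewrite -mulrBl dvdp_mulr.
Qed.

Lemma passiveD N p q : passive N p -> passive N q -> passive N (p + q).
Proof.
move=> Pp Pq x; under eq_bigr do rewrite mulrDl coefD mulrDl.
by rewrite big_split addr_ge0.
Qed.

Lemma passiveZ N (a : R) p : 0 <= a -> passive N p -> passive N (a *: p).
Proof.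
move=> a0 Pp x; under eq_bigr do rewrite -scalerAl coefZ -mulrA.
by rewrite -mulr_sumr mulr_ge0.
Qed.

(* Substituting x = f y, the form of f^-1 g at x is the form below at y. *)
Lemma passive_quotient N f g p : 'X^N %| f * p - g -> f`_0 = 1 ->
  (forall y, 0 <= \sum_(n < N) (g * y)`_n * (f * y)`_n) -> passive N p.
Proof.
move=> fpg f0 H x; have [h fh] := inverse_modXn N f0.
have := H (h * x); congr (0 <= _); apply: eq_bigr => n _.
congr (_ * _); apply: (@eqmodXn_coef N) => //; last first.
  have -> : f * (h * x) - x = (f * h - 1) * x by ring.
  by rewrite dvdp_mulr.
have -> : g * (h * x) - p * x
  = (f * h - 1) * (p * x) - (f * p - g) * (h * x) by ring.
by rewrite dvdp_sub ?dvdp_mulr.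
Qed.

Lemma passive_inv N p q : 'X^N %| p * q - 1 -> p`_0 = 1 ->
  passive N p -> passive N q.
Proof.
move=> pq p0 Pp; apply: (passive_quotient pq p0) => y.
by under eq_bigr do rewrite mul1r mulrC; exact: Pp.
Qed.

Lemma coef0_inverse N p q :
  'X^(N.+1) %| p * q - 1 -> p`_0 = 1 -> q`_0 = 1.
Proof.
move=> pq p0; have := eqmodXn_coef pq (ltn0Sn N).
by rewrite coef0M coef1 p0 mul1r.
Qed.

(* The arithmetic-harmonic mean iteration preserves passivity and the product
   of the pair; it is Newton's iteration for the square root, which converges
   X-adically. *)
Lemma passive_mean_step N f g : passive N.+1 f -> passive N.+1 g ->
  f`_0 = 1 -> g`_0 = 1 -> exists h,
  [/\ passive N.+1 h, h`_0 = 1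
    & 'X^(N.+1) %| (2^-1 *: (f + g)) * h - f * g].
Proof.
move=> Pf Pg f0 g0.
have [f' ff'] := inverse_modXn N.+1 f0; have [g' gg'] := inverse_modXn N.+1 g0.
have f'0 := coef0_inverse ff' f0; have g'0 := coef0_inverse gg' g0.
(* The inverse [h] of [m] is the harmonic mean of [f] and [g]. *)
pose m := 2^-1 *: (f' + g').
have m0 : m`_0 = 1 by rewrite coefZ coefD f'0 g'0; lra.
have Pm : passive N.+1 m.
  apply: passiveZ; first by rewrite invr_ge0.
  by apply: passiveD;
    [exact: passive_inv ff' f0 Pf|exact: passive_inv gg' g0 Pg].
have [h mh] := inverse_modXn N.+1 m0.
exists h; split; [exact: passive_inv mh m0 Pm|exact: coef0_inverse mh m0|].
have -> : 2^-1 *: (f + g) * h - f * g = (m * h - 1) * (f * g)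
   - 2^-1 *: ((f * f' - 1) * (g * h) + (g * g' - 1) * (f * h)).
  by rewrite /m -!mul_polyC; ring.
rewrite dvdp_sub ?dvdp_mulr// dvdpZr ?invr_eq0 ?pnatr_eq0//.
by rewrite dvdp_add ?dvdp_mulr.
Qed.

(** Along the iteration a ((a + b) / 2 - r) = ((a - r)^2 - (r^2 - a b)) / 2, where the last term
    vanishes to the order of truncation. The order of the error doubles; counting a gain of one per
    step already suffices after [N] steps. *)
Lemma passive_sqrt N f g r : passive N.+1 f -> passive N.+1 g ->
  f`_0 = 1 -> g`_0 = 1 -> r`_0 = 1 -> 'X^(N.+1) %| r ^+ 2 - f * g ->
  passive N.+1 r.
Proof.
move=> Pf Pg f0 g0 r0 rfg.
have iter k : (k <= N)%N -> exists a b, [/\ passive N.+1 a, passive N.+1 b,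
    a`_0 = 1, b`_0 = 1 & 'X^(N.+1) %| r ^+ 2 - a * b /\ 'X^(k.+1) %| a - r].
  elim: k => [_|k IHk kN].
    exists f, g; split => //; split => //.
    by apply/(@dvdXnP 1) => -[|//] _; rewrite coefB f0 r0 subrr.
  have [a [b [Pa Pb a0 b0 [rab ar]]]] := IHk (ltnW kN).
  have [h [Ph h0 abh]] := passive_mean_step Pa Pb a0 b0.
  have c0 : (2^-1 *: (a + b))`_0 = 1 by rewrite coefZ coefD a0 b0; lra.
  exists (2^-1 *: (a + b)), h; split => //.
    by apply: passiveZ; [rewrite invr_ge0|exact: passiveD].
  split.
    have -> : r ^+ 2 - 2^-1 *: (a + b) * h
      = (r ^+ 2 - a * b) - (2^-1 *: (a + b) * h - a * b) by ring.
    exact: dvdp_sub.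
  apply: (eqmodXn_mulI a0).
  have -> : a * (2^-1 *: (a + b) - r)
    = 2^-1 *: ((a - r) ^+ 2 - (r ^+ 2 - a * b)).
    rewrite -[RHS]mul_polyC -[_ *: (a + b)]mul_polyC.
    have -> : a * (2^-1%:P * (a + b) - r) =
      2^-1%:P * (a * (a + b)) - 1 * (a * r) by ring.
    by rewrite (_ : 1 = 2^-1%:P * 2 :> {poly R}); [ring|
      rewrite -(rmorph_nat polyC) -polyCM mulVf ?pnatr_eq0].
  rewrite dvdpZr ?invr_eq0 ?pnatr_eq0// dvdp_sub//.
    apply: dvdp_trans (_ : 'X^(k.+1 + k.+1) %| _).
      by rewrite dvdp_exp2l// addnS ltnS leq_addr.
    by rewrite exprD expr2 dvdp_mul.
  by apply: dvdp_trans rab; rewrite dvdp_exp2l.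
have [a [b [Pa _ _ _ [_ ar]]]] := iter N (leqnn N).
exact: passive_congr ar Pa.
Qed.

End TruncatedSeries.

(** * Formal powers through their differential equation *)

Section PowerFamily.
Variable R : realFieldType.
Implicit Types (d y z : {poly R}) (n N : nat) (a b c : R).

(* Up to a scalar, the only truncated series with this property is d ^ a. *)
Definition power_ode d n a y := 'X^n %| d * y^`() - a *: (d^`() * y).

Lemma power_odeM d n a b y z :
  power_ode d n a y -> power_ode d n b z -> power_ode d n (a + b) (y * z).
Proof.
rewrite /power_ode => ya zb.
have -> : d * (y * z)^`() - (a + b) *: (d^`() * (y * z))
  = (d * y^`() - a *: (d^`() * y)) * z + (d * z^`() - b *: (d^`() * z)) * y.
  by rewrite derivM -!mul_polyC polyCD; ring.
by rewrite dvdp_add ?dvdp_mulr.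
Qed.

(** For the difference w, the coefficient of index i of the equation is i + 1 times that of w at i +
    1, plus a combination of earlier ones. So the coefficients of w vanish in turn, one order beyond
    the equation. *)
Lemma power_ode_unique d n a y z : d`_0 = 1 -> y`_0 = z`_0 ->
  power_ode d n a y -> power_ode d n a z -> 'X^(n.+1) %| y - z.
Proof.
move=> d0 yz0 ya za; set w := y - z.
have wa : power_ode d n a w.
  rewrite /power_ode.
  have -> : d * w^`() - a *: (d^`() * w)
    = (d * y^`() - a *: (d^`() * y)) - (d * z^`() - a *: (d^`() * z)).
    by rewrite /w derivB -!mul_polyC; ring.
  exact: dvdp_sub.
apply/dvdXnP => i; elim/ltn_ind: i => -[_ _|i IH iN].
  by rewrite coefB yz0 subrr.
move/dvdXnP/(_ i iN): wa.
rewrite coefB coefZ !coefM big_ord_recl /= d0 subn0 mul1r.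
have w0 j : (j <= i)%N -> w`_j = 0 by move=> ji; apply: IH; lia.
rewrite big1 => [|j _]; last first.
  by rewrite coef_deriv w0 ?mul0rn ?mulr0//=;
    have := ltn_ord j; rewrite /bump; lia.
rewrite big1 => [|j _]; last by rewrite w0 ?mulr0// leq_subr.
rewrite addr0 mulr0 subr0 coef_deriv -mulr_natl => /eqP.
by rewrite mulf_eq0 pnatr_eq0 => /eqP.
Qed.

(* The coefficients of C are polynomials in the exponent, so that d ^ a is C
   with its coefficients evaluated at a. *)
Lemma power_family d n : d`_0 = 1 -> exists2 C : {poly {poly R}}, C`_0 = 1 &
  forall i, (i < n)%N ->
    (d^:P * C^`() - 'X *: (d^`()^:P * C))`_i = 0.
Proof.
move=> d0; elim: n => [|n [C C0 Codd]]; first by exists 1; rewrite ?coef1.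
set E := d^:P * _ - _ in Codd.
(* As [d] has constant coefficient 1, subtracting [u *: 'X^(n.+1)] lowers the defect of index [n] by
   n + 1 times [u] and leaves the earlier ones alone. *)
pose u := (n.+1%:R)^-1 *: E`_n.
exists (C - u *: 'X^(n.+1)); first by rewrite coefB coefZ coefXn mulr0 subr0.
move=> i; rewrite ltnS leq_eqVlt => iN.
have -> : d^:P * (C - u *: 'X^(n.+1))^`()
      - 'X *: (d^`()^:P * (C - u *: 'X^(n.+1)))
    = E - (n.+1%:R * u) *: (d^:P * 'X^n) + ('X * u) *: (d^`()^:P * 'X^(n.+1)).
  rewrite /E derivB derivZ derivXn /= -!mul_polyC !polyCM -mulr_natl.
  by rewrite polyC_natr; ring.
rewrite coefD coefB !coefZ !coefMXn ltnS.
case/orP: iN => [/eqP->|iN]; last first.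
  by rewrite Codd// iN (ltnW iN) !mulr0 subr0 addr0.
rewrite leqnn ltnn subnn mulr0 addr0 coef_map/= d0 mulr1.
rewrite /u -mul_polyC mulrA -polyC_natr -polyCM mulfV ?pnatr_eq0//.
by rewrite mul1r subrr.
Qed.

Lemma power_ode_eval d n a (C : {poly {poly R}}) :
  (forall i, (i < n)%N ->
    (d^:P * C^`() - 'X *: (d^`()^:P * C))`_i = 0) ->
  power_ode d n a (map_poly (horner_eval a) C).
Proof.
move=> CE; apply/dvdXnP => i /CE /(congr1 (horner_eval a)).
rewrite rmorph0 -coef_map rmorphB /= linearZ /= !rmorphM /=.
have mapP p : map_poly (horner_eval a) p^:P = p.
  by rewrite -map_poly_comp map_poly_id// => x _ /=;
    rewrite /horner_eval hornerC.
by rewrite !mapP deriv_map [horner_eval a 'X]/horner_eval hornerX.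
Qed.

End PowerFamily.

(** * From the exponents 0 and 1 to the whole interval *)

Section Interpolation.
Variable R : realType.
Implicit Types (d p x y : {poly R}) (n N k : nat) (a b c : R).

Lemma dyadic_approx a (e : R) : 0 <= a <= 1 -> 0 < e ->
  exists n k, (k <= 2 ^ n)%N /\ `|k%:R / 2 ^+ n - a| < e.
Proof.
move=> /andP[a0 a1] e0; pose n := (Num.truncn e^-1).+1.
have en : e^-1 < 2 ^+ n.
  rewrite (lt_le_trans (truncnS_gt _))// -/n -natrX ler_nat ltnW//.
  exact: ltn_expl.
have n0 : 0 < 2 ^+ n :> R by rewrite exprn_gt0.
exists n, (Num.truncn (a * 2 ^+ n)).
have an0 : 0 <= a * 2 ^+ n by exact: mulr_ge0 (ltW n0).
have /andP[k1 k2] := truncn_itv an0.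
split; first by rewrite -(ler_nat R) (le_trans k1)// natrX ger_pMl.
rewrite ler0_norm; last by rewrite subr_le0 ler_pdivrMr.
rewrite opprB ltrBlDr.
rewrite (@lt_trans _ _ ((Num.truncn (a * 2 ^+ n)).+1%:R / 2 ^+ n))//.
  by rewrite ltr_pdivlMr.
by rewrite -natr1 mulrDl addrC ltrD2r mul1r invf_plt ?posrE.
Qed.

(** The series d^((a + b) / 2) p is the square root of the product of d^a p and d^b p, so midpoints
    of good exponents are good. Halving [k] downwards and upwards exhibits a dyadic number as a
    midpoint at the previous level. *)
Lemma power_passive_dyadic N d p (C : {poly {poly R}}) :
    d`_0 = 1 -> p`_0 = 1 -> C`_0 = 1 ->
    (forall i, (i < N)%N -> (d^:P * C^`() - 'X *: (d^`()^:P * C))`_i = 0) ->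
    passive N.+1 p -> passive N.+1 (d * p) ->
  forall n k, (k <= 2 ^ n)%N ->
    passive N.+1 (map_poly (horner_eval (k%:R / 2 ^+ n)) C * p).
Proof.
move=> d0 p0 C0 CE Pp Pdp.
pose Ca a := map_poly (horner_eval a) C.
have Ca0 a : (Ca a)`_0 = 1 by rewrite coef_map /= C0 /horner_eval hornerE.
have Cap a : (Ca a * p)`_0 = 1 by rewrite coef0M Ca0 p0 mulr1.
have CaE a : power_ode d N a (Ca a) by exact: power_ode_eval.
have mid a b : passive N.+1 (Ca a * p) -> passive N.+1 (Ca b * p) ->
    passive N.+1 (Ca ((a + b) / 2) * p).
  move=> Pa Pb; apply: (passive_sqrt Pa Pb) => //.
  set m := Ca (_ / 2).
  have -> : (m * p) ^+ 2 - Ca a * p * (Ca b * p) =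
    (m * m - Ca a * Ca b) * p ^+ 2 by ring.
  rewrite dvdp_mulr// (@power_ode_unique _ d _ (a + b))//.
  - by rewrite !coef0M !Ca0.
  - by rewrite [a + b]splitr; exact: power_odeM.
  - exact: power_odeM.
have C_0 : passive N.+1 (Ca 0 * p).
  apply: passive_congr Pp; rewrite -[X in X - _]mul1r -mulrBl dvdp_mulr//.
  rewrite (@power_ode_unique _ d _ 0)// ?Ca0 ?coef1//.
  by rewrite /power_ode derivC mulr0 scale0r subr0 dvdp0.
have C_1 : passive N.+1 (Ca 1 * p).
  apply: passive_congr Pdp; rewrite -mulrBl dvdp_mulr//.
  rewrite (@power_ode_unique _ d _ 1)// ?Ca0 ?d0//.
  by rewrite /power_ode scale1r mulrC subrr dvdp0.
elim=> [|n IH] k.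
  by rewrite expn0 expr0 divr1; case: k => [|[|]].
move=> kn; have -> : k%:R / 2 ^+ n.+1
  = ((k./2)%:R / 2 ^+ n + (uphalf k)%:R / 2 ^+ n) / 2 :> R.
  rewrite -mulrDl -natrD -mulrA -invfM -exprSr; congr (_%:R / _).
  by rewrite -{1}(odd_double_half k) uphalf_half -addnn; lia.
apply: mid; apply: IH.
  by rewrite leq_half_double -mul2n -expnS (leq_trans kn).
by rewrite leq_uphalf_double -mul2n -expnS.
Qed.

(** For a fixed [x] the form is a polynomial [Q] in the exponent. Were it negative at [a],
    continuity would make it negative at a nearby dyadic exponent. *)
Lemma power_passive N d p y a : d`_0 = 1 -> p`_0 = 1 -> y`_0 = 1 ->
    passive N.+1 p -> passive N.+1 (d * p) ->
    0 <= a <= 1 -> power_ode d N a y -> passive N.+1 (y * p).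
Proof.
move=> d0 p0 y0 Pp Pdp a01 ya.
have [C C0 CE] := power_family N d0.
suff : passive N.+1 (map_poly (horner_eval a) C * p).
  apply: passive_congr; rewrite -mulrBl dvdp_mulr//.
  apply: (power_ode_unique d0) ya; last exact: power_ode_eval.
  by rewrite coef_map /= C0 /horner_eval hornerE y0.
move=> x.
pose Q : {poly R} := \sum_(n < N.+1) (C * (p * x)^:P)`_n * (x`_n)%:P.
have QE b : \sum_(n < N.+1) (map_poly (horner_eval b) C * p * x)`_n * x`_n
    = Q.[b].
  rewrite horner_sum; apply: eq_bigr => n _; rewrite hornerM hornerC.
  have pxE : map_poly (horner_eval b) (p * x)^:P = p * x.
    by rewrite -map_poly_comp map_poly_id// => u _;
      rewrite /= /horner_eval hornerC.
  by rewrite -[_.[b]]/(horner_eval b _) -coef_map rmorphM /= pxE mulrA.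
rewrite QE leNgt; apply/negP => Qa.
have /cvgrPdist_lt /(_ (- Q.[a])) := @continuous_horner R Q a.
rewrite oppr_gt0 => /(_ Qa) /nbhs_ballP[e /= e0 He].
have [n [k [kn ak]]] := dyadic_approx a01 e0.
have := power_passive_dyadic d0 p0 C0 CE Pp Pdp kn x.
rewrite QE; have := He (k%:R / 2 ^+ n); rewrite /ball /= distrC => /(_ ak).
rewrite ltr_norml => /andP[+ _]; lra.
Qed.

End Interpolation.

(** * Energy estimates for the four-step formula and its multiplier *)

Section BDF4.
Variable R : realFieldType.
Implicit Types (p y : {poly R}) (N : nat).

Definition multiplier : {poly R} := 1 - 2^-1 *: 'X.

(** The sum of (1 - X)^j / j for j from 1 to 4, divided by its constant coefficient 25/12. *)
Definition bdf4 : {poly R} := 1 - (48 / 25) *: 'X + (36 / 25) *: 'X^2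
  - (16 / 25) *: 'X^3 + (3 / 25) *: 'X^4.

(** The coefficient of index n - 4, read as 0 when n < 4; this supplies zero starting values. *)
Definition delay4 y n : R := (y * 'X^4)`_n.

Lemma coef_delay4 y i n : (i <= 4)%N -> ('X^i * y)`_n = delay4 y (n + 4 - i).
Proof.
move=> i4; rewrite mulrC /delay4 !coefMXn.
have -> : (n + 4 - i < 4)%N = (n < i)%N by lia.
by case: ifP => // _; congr (y`_ _); lia.
Qed.

Lemma coef_multiplierM y n : (multiplier * y)`_n
  = delay4 y (n + 4) - 2^-1 * delay4 y (n + 3).
Proof.
rewrite /multiplier mulrBl coefB -scalerAl coefZ.
by rewrite -[1 in LHS](expr0 'X) -['X in LHS]expr1 !coef_delay4// subn0 -addnBA.
Qed.

Lemma coef_bdf4M y n : (bdf4 * y)`_n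
  = delay4 y (n + 4) - 48 / 25 * delay4 y (n + 3) + 36 / 25 * delay4 y (n + 2)
    - 16 / 25 * delay4 y (n + 1) + 3 / 25 * delay4 y n.
Proof.
rewrite /bdf4 !(mulrDl _ _ y) !mulNr !(coefD, coefN) -!(scalerAl _ _ y) !coefZ.
rewrite -[1 in LHS](expr0 'X) -['X in LHS]expr1 !coef_delay4// subn0.
by rewrite -!addnBA// addn0.
Qed.

(** The form becomes the sum of y_n (y_n - y_(n-1) / 2). Completing squares shows that it dominates
    the storage y_(N-1)^2 / 4. *)
Lemma passive_inv_multiplier N p :
  'X^N %| multiplier * p - 1 -> passive N p.
Proof.
move/passive_quotient; apply.
  by rewrite coefB coefZ coef1 coefX mulr0 subr0.
move=> y.
suff : 4^-1 * delay4 y (N + 3) ^+ 2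
    <= \sum_(n < N) (1 * y)`_n * (multiplier * y)`_n.
  by apply: le_trans; rewrite mulr_ge0 ?invr_ge0 ?sqr_ge0.
elim: N => [|N IH].
  by rewrite big_ord0 /delay4 coefMXn/= expr0n mulr0.
rewrite big_ord_recr /= coef_multiplierM.
have := @coef_delay4 y 0 N isT; rewrite expr0 subn0 => ->.
rewrite addSnnS (le_trans _ (lerD IH (lexx _)))//.
set u := delay4 _ _; set v := delay4 _ _.
rewrite -subr_ge0.
have -> : 4^-1 * v ^+ 2 + u * (u - 2^-1 * v) - 4^-1 * u ^+ 2 =
  (2^-1 * v - 2^-1 * u) ^+ 2 + 2^-1 * u ^+ 2 by field.
by rewrite addr_ge0 ?sqr_ge0 ?(mulr_ge0 _ (sqr_ge0 _)) ?invr_ge0.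
Qed.

Lemma weighted_sqr_ge0 (m n : nat) (a : R) : 0 <= m%:R / n%:R * a ^+ 2.
Proof. by rewrite mulr_ge0 ?sqr_ge0// divr_ge0. Qed.

(** An energy of four consecutive values, latest first, in completed squares; [1%:R] gives its
    weight the shape expected by [weighted_sqr_ge0]. *)
Definition bdf4_storage (a b c d : R) :=
  3 / 2 * (a - b + 11 / 24 * c - 1 / 9 * d) ^+ 2 + 1%:R / 6 * (b - 3 / 4 * c) ^+ 2
  + 35 / 384 * (c - 32 / 105 * d) ^+ 2 + 37 / 2520 * d ^+ 2.

Lemma bdf4_storage_ge0 a b c d : 0 <= bdf4_storage a b c d.
Proof.
rewrite /bdf4_storage; do 3!(apply: addr_ge0; last exact: weighted_sqr_ge0).
exact: weighted_sqr_ge0.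
Qed.

(* On the unit circle, the real part of 25/12 bdf4 times the conjugate of the
   multiplier is |1 - z|^2 / 2 times a positive trigonometric polynomial of
   degree 3.  Writing the latter as a sum of squares leaves a telescoping
   remainder, the storage. *)
Lemma bdf4_dissipation (a b c d e : R) :
  bdf4_storage a b c d <= bdf4_storage b c d e
  + 25 / 12 * ((a - 48 / 25 * b + 36 / 25 * c - 16 / 25 * d + 3 / 25 * e)
               * (a - 2^-1 * b)).
Proof.
rewrite -subr_ge0.
(* The factor |1 - z|^2 makes the gap a form in consecutive differences; the squares below
   diagonalise a Gram matrix of the remaining trigonometric polynomial. *)
pose s := a - b; pose t := b - c; pose u := c - d; pose v := d - e.
set lhs := (X in 0 <= X).
have -> : lhs = 2^-1 * (7 / 6 * (s - 3 / 4 * t + 9 / 14 * u - 3 / 14 * v) ^+ 2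
  + 3 / 32 * (t + 2 / 3 * u + 2 / 9 * v) ^+ 2
  + 5 / 84 * (u + 11 / 30 * v) ^+ 2 + 37 / 2160 * v ^+ 2).
  by rewrite /lhs /bdf4_storage /s /t /u /v; field.
apply: mulr_ge0; first by rewrite invr_ge0.
do 3!(apply: addr_ge0; last exact: weighted_sqr_ge0).
exact: weighted_sqr_ge0.
Qed.

(** The dissipation inequality telescopes from zero storage, so the form dominates the final
    storage. *)
Lemma passive_bdf4_quotient N p :
  'X^N %| multiplier * p - 1 -> passive N (bdf4 * p).
Proof.
move=> mp; apply: (@passive_quotient _ _ multiplier bdf4).
- have -> : multiplier * (bdf4 * p) - bdf4 = bdf4 * (multiplier * p - 1).
    by ring.
  exact: dvdp_mull.
- by rewrite coefB coefZ coef1 coefX mulr0 subr0.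
move=> y; rewrite -(@pmulr_rge0 _ (25 / 12)) ?divr_gt0// mulr_sumr {mp}.
suff : bdf4_storage (delay4 y (N + 3)) (delay4 y (N + 2)) (delay4 y (N + 1))
    (delay4 y N)
    <= \sum_(n < N) 25 / 12 * ((bdf4 * y)`_n * (multiplier * y)`_n).
  exact: le_trans (bdf4_storage_ge0 _ _ _ _).
elim: N => [|N IH].
  by rewrite big_ord0 /delay4 !coefMXn/= /bdf4_storage; lra.
rewrite big_ord_recr /= coef_multiplierM coef_bdf4M !addSnnS.
rewrite -(addn1 N); apply: le_trans (bdf4_dissipation _ _ _ _ (delay4 y N)) _.
by rewrite lerD2r.
Qed.

End BDF4.

(** * From convergence on a real interval to identities of coefficients *)

Section PowerSeries.
Variable R : realType.
Implicit Types (c e : R^nat) (z r l a : R) (p : {poly R}) (F : R -> R).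

Lemma cvg_pseries0 c : pseries c 0 @ \oo --> c 0%N.
Proof.
rewrite -cvg_shiftS; apply: cvg_near_cst; apply: nearW => n.
rewrite /pseries /series /= big_nat_recl//= expr0 mulr1 big1 ?addr0// => i _.
by rewrite expr0n mulr0.
Qed.

(** For |z| < s < |r|, factoring s^(n+1) - |z|^(n+1) gives (s - |z|) (n + 1) |z|^n <= s^(n+1), so
    the differentiated series is dominated by a multiple of the absolutely convergent series at
    s. *)
Lemma is_cvg_pseries_diffs c z r :
  cvgn (pseries c r) -> `|z| < `|r| -> cvgn (pseries (pseries_diffs c) z).
Proof.
move=> cr zr; pose s := (`|z| + `|r|) / 2.
have zs : `|z| < s by rewrite /s; lra.
have sr : `|s| < `|r| by rewrite ger0_norm /s; have := normr_ge0 z; lra.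
have s0 : 0 <= s by rewrite (le_trans _ (ltW zs)).
have szpow n : (s - `|z|) * (n.+1%:R * `|z| ^+ n) <= s ^+ n.+1.
  apply: le_trans (_ : s ^+ n.+1 - `|z| ^+ n.+1 <= _); last first.
    by rewrite gerBl exprn_ge0.
  rewrite subrXX ler_wpM2l//; first by rewrite subr_ge0 ltW.
  have -> : n.+1%:R * `|z| ^+ n = \sum_(i < n.+1) `|z| ^+ n.
    by rewrite sumr_const card_ord mulr_natl.
  apply: ler_sum => -[i /=]; rewrite ltnS => iN _.
  by rewrite -{1}(subnK iN) exprD ler_wpM2r ?exprn_ge0// lerXn2r ?nnegrE// ?ltW.
have cs := is_cvg_pseries_inside_norm cr sr.
apply: normed_cvg; rewrite /normed_series_of /=.
apply: (@series_le_cvg _ _ (fun n => (s - `|z|)^-1 * (`|c n.+1| * s ^+ n.+1))).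
- by move=> n; rewrite normr_ge0.
- by move=> n; rewrite mulr_ge0 ?mulr_ge0 ?exprn_ge0// invr_ge0 subr_ge0 ltW.
- move=> n; rewrite /pseries_diffs !normrM normr_nat normrX.
  rewrite ler_pdivlMl ?subr_gt0//.
  rewrite [n.+1%:R * _]mulrC -mulrA mulrCA ler_wpM2l//.
apply: is_cvg_seriesZ.
rewrite (_ : series _ = fun n => pseries (fun i => `|c i|) s n.+1 - `|c 0|).
  apply: is_cvgB; last exact: is_cvg_cst.
  by apply: (cvgP (limn (pseries (fun i => `|c i|) s))); rewrite cvg_shiftS.
apply/funext => n; rewrite /pseries /series /= big_nat_recl//=.
by rewrite expr0 mulr1 addrC addKr.
Qed.

Lemma pseries_mul_poly p c z l : pseries c z @ \oo --> l ->
  pseries (fun n => \sum_(i < n.+1) p`_i * c (n - i)%N) z @ \oo --> p.[z] * l.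
Proof.
move=> cl; elim/poly_ind: p => [|p a IH].
  rewrite horner0 mul0r; apply: cvg_near_cst; apply: nearW => n.
  rewrite /pseries /series /= big1// => i _; rewrite big1 ?mul0r// => j _.
  by rewrite coef0 mul0r.
rewrite -cvg_shiftS hornerMXaddC.
set e := fun n => _ in IH.
rewrite [X in X @ _ --> _](_ : _ =
  (fun n => pseries e z n * z + a * pseries c z n.+1)); last first.
  apply/funext => n; rewrite /pseries /series /= mulr_suml mulr_sumr.
  rewrite big_nat_recl//= [in RHS](big_nat_recl n)//= addrCA -big_split /=.
  congr (_ + _).
    by rewrite big_ord1 subn0 coefD coefMX coefC /= add0r expr0 mulrA.
  apply: eq_bigr => i _; rewrite big_ord_recl /= coefD coefMX coefC/= add0r.
  rewrite subn0 mulrDl addrC; congr (_ + _); first by rewrite mulrA.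
  rewrite exprSr mulrA.
  congr (_ * _ * _); apply: eq_bigr => j _.
  by rewrite coefD coefMX coefC /= addr0 subSS.
rewrite mulrDl mulrAC; apply: cvgD; first by apply: cvgM => //; exact: cvg_cst.
by apply: cvgM; [exact: cvg_cst|rewrite (cvg_shiftS (pseries c z))].
Qed.


Lemma is_derive_pseries c F r z :
    (forall y, `|y| < r -> pseries c y @ \oo --> F y) ->
  `|z| < r -> is_derive z (1 : R) F (limn (pseries (pseries_diffs c) z)).
Proof.
(* Each termwise differentiation shrinks the radius: the series converges at [t], its derivative at
   [t'] between [s] and [t], and its second derivative at [s]. *)
move=> cF zr; pose s := (`|z| + r) / 2; pose t := (s + r) / 2.
have z0 := normr_ge0 z.
have [zs st tr] : [/\ `|z| < s, s < t & t < r] by split; rewrite /t /s; lra.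
have s0 : `|s| = s by rewrite ger0_norm /s; lra.
have t0 : `|t| = t by rewrite ger0_norm /t; lra.
have ct : cvgn (pseries c t).
  by apply/cvg_ex; exists (F t); apply: cF; rewrite t0.
pose t' := (s + t) / 2; have t'0 : `|t'| = t' by rewrite ger0_norm /t'; lra.
have [st' tt'] : s < t' /\ t' < t by rewrite /t'; split; lra.
have dct' : cvgn (pseries (pseries_diffs c) t').
  by apply: is_cvg_pseries_diffs ct _; rewrite t'0 t0.
apply: (near_eq_is_derive (f := fun x => limn (pseries c x))); last first.
  apply: (@pseries_snd_diffs _ c s) => //; last by rewrite s0.
  - by apply: is_cvg_pseries_inside ct _; rewrite s0 t0.
  - by apply: is_cvg_pseries_inside dct' _; rewrite s0 t'0.
  - by apply: is_cvg_pseries_diffs dct' _; rewrite s0 t'0.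
near=> y; apply/cvg_lim => //; apply: cF; near: y.
apply/nbhs_ballP; exists (r - `|z|) => /=; first by rewrite subr_gt0.
move=> y /=; rewrite /ball /= => zy.
rewrite -(subrK z y) (le_lt_trans (ler_normD _ _))// -ltrBrDr distrC//.
Unshelve. all: by end_near. Qed.

(** The value at 0 is [e 0], and the derived series vanishes on the same interval, so induction
    applies to [pseries_diffs e]. *)
Lemma pseries_eq0 e r : 0 < r ->
  (forall z, `|z| < r -> pseries e z @ \oo --> (0 : R)) -> forall n, e n = 0.
Proof.
move=> r0 e0 n; elim: n e e0 => [|n IH] e e0.
  have := e0 0; rewrite normr0 => /(_ r0).
  have h1 := @cvg_pseries0 e; move=> h2; exact: (cvg_unique _ h1 h2).
have := IH (pseries_diffs e); rewrite /pseries_diffs => /(_ _)/eqP.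
rewrite mulf_eq0 pnatr_eq0/= => /(_ _)/eqP; apply => z zr.
have [s /andP[zs sr]] : exists s, `|z| < s < r.
  by exists ((`|z| + r) / 2); rewrite midf_lt// ; apply/andP; split; lra.
have s0 : `|s| = s by rewrite ger0_norm// ltW// (le_lt_trans _ zs).
have dz : is_derive z (1 : R) (cst 0) (limn (pseries (pseries_diffs e) z)).
  by apply: is_derive_pseries zr => y /e0.
have := @derive_val _ _ _ _ _ _ _ dz; rewrite derive_cst => ->.
apply: (@is_cvg_pseries_diffs e z s); last by rewrite s0.
by apply/cvg_ex; exists 0; apply: e0; rewrite s0.
Qed.

(** The function F = p^a satisfies p F' = a p' F near 0. Below, [e k] is the coefficient of index
    [k] of the difference of the two sides, hence 0. *)
Lemma pseries_power_ode p c a n : p`_0 = 1 ->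
    (\forall z \near (0 : R), pseries c z @ \oo --> p.[z] `^ a) ->
  c 0%N = 1 /\ power_ode p n a (\poly_(i < n.+1) c i).
Proof.
move=> p0 cE.
have pz0 : \forall z \near (0 : R), 0 < p.[z].
  by apply: (cvgr_gt _ (@continuous_horner R p 0)); rewrite horner_coef0 p0.
have /nbhs_ballP[r /= r0 Hr] : \forall z \near (0 : R),
    pseries c z @ \oo --> p.[z] `^ a /\ 0 < p.[z].
  by near=> z; split; near: z.
have {}cE z : `|z| < r -> pseries c z @ \oo --> p.[z] `^ a.
  by move=> zr; apply: (Hr _ _).1; rewrite /ball/= sub0r normrN.
have {pz0} pgt0 z : `|z| < r -> 0 < p.[z].
  by move=> zr; apply: (Hr _ _).2; rewrite /ball/= sub0r normrN.
pose dc := pseries_diffs c.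
pose e k := \sum_(i < k.+1) p`_i * dc (k - i)%N
  - a * \sum_(i < k.+1) p^`()`_i * c (k - i)%N.
have e0 : forall k, e k = 0.
  apply: (pseries_eq0 r0) => z zr.
  have dpa : is_derive z (1 : R) (fun x => p.[x] `^ a)
      ((a * p.[z] `^ (a - 1)) * p^`().[z]).
    exact: is_derive1_comp (is_derive1_powR a (pgt0 z zr)) (is_derive_poly p z).
  have dF := is_derive_pseries cE zr.
  have limE : limn (pseries dc z) = a * p.[z] `^ (a - 1) * p^`().[z].
    have := @derive_val _ _ _ _ _ _ _ dpa.
    by rewrite (@derive_val _ _ _ _ _ _ _ dF).
  have [s /andP[zs sr]] : exists s, `|z| < s < r.
    by exists ((`|z| + r) / 2); apply/andP; split; lra.
  have s0 : `|s| = s by rewrite ger0_norm// ltW// (le_lt_trans _ zs).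
  have dcz : pseries dc z @ \oo --> a * p.[z] `^ (a - 1) * p^`().[z].
    rewrite -limE; apply: (@is_cvg_pseries_diffs c z s); last by rewrite s0.
    by apply/cvg_ex; exists (p.[s] `^ a); apply: cE; rewrite s0.
  have h1 := @pseries_mul_poly p _ _ _ dcz.
  have h2 := @pseries_mul_poly p^`() _ _ _ (cE _ zr).
  have -> : (0 : R) = p.[z] * (a * p.[z] `^ (a - 1) * p^`().[z])
      - a * (p^`().[z] * p.[z] `^ a).
    rewrite (_ : p.[z] `^ a = p.[z] * p.[z] `^ (a - 1)); first by ring.
    rewrite -[X in _ = X * _](powRr1 (ltW (pgt0 _ zr))) -powRD ?subrKC//.
    by rewrite (gt_eqF (pgt0 _ zr)) implybT.
  rewrite (_ : pseries e z = fun k =>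
    pseries (fun n => \sum_(i < n.+1) p`_i * dc (n - i)%N) z k
    - a * pseries (fun n => \sum_(i < n.+1) p^`()`_i * c (n - i)%N) z k).
    by apply: cvgB => //; apply: cvgM => //; exact: cvg_cst.
  apply/funext => k; rewrite /pseries /series /= mulr_sumr -sumrB.
  by apply: eq_bigr => i _; rewrite /e mulrBl mulrA.
split.
  have := cE 0; rewrite normr0 => /(_ r0).
  have h1 := @cvg_pseries0 c.
  rewrite horner_coef0 p0 powR1 => h2; exact: (cvg_unique _ h1 h2).
apply/dvdXnP => i iN; rewrite coefB coefZ !coefM -[RHS](e0 i) /e.
congr (_ - a * _); apply: eq_bigr => j _; congr (_ * _).
  rewrite coef_deriv coef_poly ltnS (leq_ltn_trans (leq_subr _ _) iN).
  by rewrite /dc /pseries_diffs mulr_natl.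
by rewrite coef_poly ltnS (leq_trans (leq_subr _ _))// ltnW.
Unshelve. all: by end_near. Qed.

End PowerSeries.

(** * Positive kernels, their pairing, and summation by parts *)

Section Kernels.
Variable R : realFieldType.
Implicit Types (A G : nat -> nat -> R) (q w s x : nat -> R) (N : nat).

(** Also meant for nonsymmetric kernels, such as the triangular kernel of a convolution, whose
    symmetric part is tested. *)
Definition positive_kernel N A :=
  forall x, 0 <= \sum_(i < N) \sum_(j < N) A i j * (x i * x j).

(** Moving one coordinate makes the form quadratic in [t]; suitable values of [t] give the sign of
    the pivot, the vanishing of its row and the positivity of the Schur complement. *)
Lemma quad_form_shift N G x (t : R) : (forall i j, G i j = G j i) ->
  let y i := if i is 0%N then x 0%N + t else x i in
  \sum_(i < N.+1) \sum_(j < N.+1) G i j * (y i * y j)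
  = \sum_(i < N.+1) \sum_(j < N.+1) G i j * (x i * x j)
    + 2 * t * (\sum_(j < N.+1) G 0%N j * x j) + t ^+ 2 * G 0%N 0%N.
Proof.
move=> Gsym y.
have split0 (z : nat -> R) : \sum_(i < N.+1) \sum_(j < N.+1) G i j * (z i * z j)
    = G 0%N 0%N * (z 0%N * z 0%N)
      + 2 * z 0%N * (\sum_(j < N) G 0%N j.+1 * z j.+1)
      + \sum_(i < N) \sum_(j < N) G i.+1 j.+1 * (z i.+1 * z j.+1).
  set b := \sum_(j < N) G 0%N _ * _; set S := \sum_(i < N) \sum_(j < N) _.
  have -> : G 0%N 0%N * (z 0%N * z 0%N) + 2 * z 0%N * b + S
    = (G 0%N 0%N * (z 0%N * z 0%N) + z 0%N * b) + (z 0%N * b + S) by ring.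
  rewrite big_ord_recl; congr (_ + _).
    rewrite big_ord_recl mulr_sumr; congr (_ + _).
    by apply: eq_bigr => i _; rewrite [RHS]mulrCA.
  rewrite /b mulr_sumr -big_split; apply: eq_bigr => i _.
  by rewrite big_ord_recl Gsym; congr (_ + _); rewrite mulrA mulrC.
rewrite !split0 big_ord_recl /=; ring.
Qed.

(* Symmetric elimination writes G as a sum of d_k l_k l_k^T with d_k >= 0, and
   A is nonnegative on each l_k.  When the pivot G 0 0 vanishes, so does its
   row, and the junk value 1 / 0 = 0 makes the elimination step trivial. *)
Lemma positive_kernel_pairing N A G : positive_kernel N A ->
  (forall i j, G i j = G j i) -> positive_kernel N G ->
  0 <= \sum_(i < N) \sum_(j < N) A i j * G i j.
Proof.
elim: N A G => [|N IH] A G PA Gsym PG; first by rewrite big_ord0.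
pose g i := G 0%N i; pose G' i j := G i j - g i * g j / G 0%N 0%N.
have shift x t : 0 <= \sum_(i < N.+1) \sum_(j < N.+1) G i j * (x i * x j)
    + 2 * t * (\sum_(j < N.+1) g j * x j) + t ^+ 2 * G 0%N 0%N.
  by rewrite -quad_form_shift//; exact: PG (fun i => if i is 0%N then x 0%N + t else x i).
have G00 : 0 <= G 0%N 0%N.
  have := shift (fun=> 0) 1.
  rewrite big1 => [|i _]; last by rewrite big1// => j _; rewrite !mulr0.
  by rewrite big1 => [|i _]; rewrite ?mulr0// expr1n mul1r !add0r.
have gx0 x : G 0%N 0%N = 0 -> \sum_(j < N.+1) g j * x j = 0.
  move=> G0; set b := \sum_(j < N.+1) _.
  set a := \sum_(i < N.+1) \sum_(j < N.+1) G i j * (x i * x j).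
  have h t : 0 <= a + 2 * t * b by have := shift x t; rewrite G0 mulr0 addr0.
  (* This [t] gives the affine function a + 2 t b the value -1. *)
  apply/eqP/negPn/negP => b0; have := h (- (a + 1) / (2 * b)).
  have -> : a + 2 * (- (a + 1) / (2 * b)) * b = -1 by field.
  by rewrite lerNr oppr0 ler10.
have g0 i : (i < N.+1)%N -> G 0%N 0%N = 0 -> g i = 0.
  move=> iN /(gx0 (fun j => (j == i)%:R)).
  rewrite (bigD1 (Ordinal iN))//= eqxx mulr1 big1 ?addr0// => j ji.
  by rewrite -val_eqE/= in ji; rewrite (negbTE ji) mulr0.
have G'0 i : (i < N.+1)%N -> G' 0%N i = 0.
  move=> iN; rewrite /G' {1}/g mulrAC; have [G0|G0] := eqVneq (G 0%N 0%N) 0.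
    by rewrite G0 invr0 mulr0 mul0r subr0; exact: g0.
  by rewrite divff// mul1r subrr.
have G's i j : G' i j = G' j i by rewrite /G' Gsym [g i * _]mulrC.
have sumG' (B : nat -> nat -> R) : \sum_(i < N.+1) \sum_(j < N.+1) B i j * G i j
    = (G 0%N 0%N)^-1 * (\sum_(i < N.+1) \sum_(j < N.+1) B i j * (g i * g j))
      + \sum_(i < N) \sum_(j < N) B i.+1 j.+1 * G' i.+1 j.+1.
  transitivity ((G 0%N 0%N)^-1 *
      (\sum_(i < N.+1) \sum_(j < N.+1) B i j * (g i * g j))
      + \sum_(i < N.+1) \sum_(j < N.+1) B i j * G' i j).
    rewrite mulr_sumr -big_split; apply: eq_bigr => i _ /=.
    rewrite mulr_sumr -big_split; apply: eq_bigr => j _ /=.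
    by rewrite /G'; ring.
  congr (_ + _); rewrite big_ord_recl big1 ?add0r => [|j _]; last first.
    by rewrite G'0 ?mulr0.
  by apply: eq_bigr => i _; rewrite big_ord_recl G's G'0 ?mulr0 ?add0r.
rewrite sumG' addr_ge0//; first by rewrite mulr_ge0 ?invr_ge0.
apply: (IH (fun i j => A i.+1 j.+1) (fun i j => G' i.+1 j.+1)) => // x.
  have := PA (fun i => if i is j.+1 then x j else 0).
  rewrite big_ord_recl big1 ?add0r => [|j _]; last by rewrite mul0r mulr0.
  congr (0 <= _); apply: eq_bigr => i _.
  by rewrite big_ord_recl /= !mulr0 add0r.
pose x' i := if i is j.+1 then x j else 0.
(* For a nonzero pivot this [t] minimises the quadratic, and the minimum is the form of the Schur
   complement [G'] at [x]. *)
have := shift x' (- (\sum_(j < N.+1) g j * x' j) / G 0%N 0%N).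
set b := \sum_(j < N.+1) g j * x' j.
have -> : \sum_(i < N.+1) \sum_(j < N.+1) G i j * (x' i * x' j)
  = (G 0%N 0%N)^-1 * b ^+ 2
    + \sum_(i < N) \sum_(j < N) G' i.+1 j.+1 * (x i * x j).
  under eq_bigr do under eq_bigr do rewrite mulrC.
  rewrite (sumG' (fun i j => x' i * x' j)); congr (_ * _ + _); last first.
    by apply: eq_bigr => i _; apply: eq_bigr => j _; rewrite mulrC.
  rewrite expr2 {1}/b mulr_suml; apply: eq_bigr => i _.
  by rewrite mulr_sumr; apply: eq_bigr => j _; ring.
have [G0|G0] := eqVneq (G 0%N 0%N) 0.
  by rewrite G0 invr0 !(mulr0, mul0r, add0r, addr0).
set S := \sum_(i < N) _; congr (0 <= _); field.
exact: G0.
Qed.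

Lemma sum_antidiagonal N n (F : nat -> nat -> R) : (n < N)%N ->
  \sum_(j < n.+1) F j (n - j)%N = \sum_(i < N) (i <= n)%:R * F (n - i)%N i.
Proof.
move=> nN; rewrite (reindex_inj rev_ord_inj) /=.
rewrite (big_ord_widen N (fun i => F (n.+1 - i.+1) (n - (n.+1 - i.+1)))%N)//.
rewrite big_mkcond; apply: eq_bigr => i _; rewrite ltnS subSS.
by case: ifP => iN; rewrite ?mul0r ?mul1r// subKn.
Qed.

(** The hypothesis on [q] says that the lower triangular Toeplitz kernel of [q] is positive; it is
    then paired with [G]. *)
Lemma convolution_pairing N q G :
    (forall x, 0 <= \sum_(n < N) \sum_(j < n.+1) q j * (x (n - j)%N * x n)) ->
    (forall i j, G i j = G j i) -> positive_kernel N G ->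
  0 <= \sum_(n < N) \sum_(j < n.+1) q j * G (n - j)%N n.
Proof.
move=> Pq Gsym PG.
have sumE (H : nat -> nat -> R) :
    \sum_(n < N) \sum_(j < n.+1) q j * H (n - j)%N n
    = \sum_(n < N) \sum_(i < N) ((i <= n)%:R * q (n - i)%N) * H i n.
  apply: eq_bigr => n _.
  rewrite (sum_antidiagonal (fun j i => q j * H i n) (ltn_ord n)).
  by apply: eq_bigr => i _; rewrite mulrA.
rewrite (sumE G).
have := @positive_kernel_pairing N (fun n i => (i <= n)%:R * q (n - i)%N) G.
under [X in _ -> _ -> _ -> 0 <= X]eq_bigr do under eq_bigr do rewrite Gsym.
apply => // x; have := Pq x; rewrite (sumE (fun i n => x i * x n)).
congr (0 <= _); apply: eq_bigr => n _; apply: eq_bigr => i _.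
by rewrite [x i * _]mulrC.
Qed.

(** The induction carries the stronger bound by [w N] times the partial sum. *)
Lemma abel_summation_ge0 w s N :
    (forall n, 0 <= w n) -> (forall n, w n.+1 <= w n) ->
    (forall n, 0 <= \sum_(i < n) s i) ->
  0 <= \sum_(i < N) w i * s i.
Proof.
move=> w0 wS s0; suff : w N * \sum_(i < N) s i <= \sum_(i < N) w i * s i.
  by apply: le_trans; rewrite mulr_ge0.
elim: N => [|N IH]; first by rewrite !big_ord0 mulr0.
rewrite [X in _ <= X]big_ord_recr /=.
apply: le_trans (lerD IH (lexx _)).
have -> : w N * \sum_(i < N) s i + w N * s N = w N * \sum_(i < N.+1) s i.
  by rewrite big_ord_recr mulrDr.
by rewrite ler_wpM2r ?s0 ?wS.
Qed.

End Kernels.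

(** * The inequality for real sequences, with damping *)

Section Scalar.
Variable R : realType.
Implicit Types (g h x : R^nat) (alpha sigma tau : R) (N : nat).

Lemma half_inverse N :
  'X^N %| multiplier R * \poly_(i < N) (2 ^+ i)^-1 - 1.
Proof.
apply/dvdXnP => i iN; rewrite /multiplier mulrBl mul1r -scalerAl.
rewrite !coefB coefZ coefXM !coef_poly iN coef1.
case: i iN => [|i] iN /=; first by rewrite mulr0 expr0 invr1 subr0 subrr.
by rewrite (ltnW iN) exprS invfM subrr subr0.
Qed.

Lemma coef0_bdf4 : (bdf4 R)`_0 = 1.
Proof.
rewrite /bdf4 !(coefD, coefN, coefZ, coefXn, coefX, coef1).
by rewrite !mulr0 !subr0 !addr0.
Qed.

Lemma bdf4_power_form_ge0 alpha h : 0 < alpha < 1 ->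
    (\forall z \near (0 : R), pseries h z @ \oo --> (bdf4 R).[z] `^ alpha) ->
  forall N x, 0 <= \sum_(n < N) \sum_(j < n.+1)
    (\sum_(m < j.+1) (2 ^+ m)^-1 * h (j - m)%N) * (x (n - j)%N * x n).
Proof.
move=> /andP[a0 a1] hE [|N] x; first by rewrite big_ord0.
have b0 := coef0_bdf4.
have [h0 hode] := pseries_power_ode N b0 hE.
pose p : {poly R} := \poly_(i < N.+1) (2 ^+ i)^-1.
have p0 : p`_0 = 1 by rewrite coef_poly expr0 invr1.
have : passive N.+1 (\poly_(i < N.+1) h i * p).
  apply: (power_passive b0 p0 _ _ _ _ hode); first by rewrite coef_poly.
  - exact: passive_inv_multiplier (half_inverse _).
  - exact: passive_bdf4_quotient (half_inverse _).
  - by rewrite !ltW.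
move/(_ (\poly_(i < N.+1) x i)); congr (0 <= _); apply: eq_bigr => n _.
rewrite coef_poly ltn_ord coefM mulr_suml; apply: eq_bigr => j _.
rewrite coef_poly (leq_ltn_trans (leq_subr _ _) (ltn_ord n)) mulrA.
have jN : (j <= N)%N by have := ltn_ord j; have := ltn_ord n; lia.
congr (_ * _ * _); rewrite mulrC coefM; apply: eq_bigr => m _.
have mj := ltn_ord m; rewrite !coef_poly !ifT//; lia.
Qed.

Lemma bdf_symbol4E sigma tau (z : R) :
  bdf_symbol 4 sigma tau z = 25 / 12 * (bdf4 R).[expR (- (sigma * tau)) * z].
Proof.
rewrite /bdf_symbol 4?big_nat_recr//= big_geq// /bdf4.
rewrite !(hornerD, hornerN, hornerZ, hornerXn, hornerX, hornerC).
by set u := expR _ * z; field.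
Qed.

(** Rescaling z by rho = e^(-sigma tau) gives q_j = K rho^j qt_j, with [qt] the undamped
    coefficients and K = (25/12)^alpha. Putting x_n = rho^n u_n, the summand of index n acquires the
    weight rho^(2n), nonincreasing because rho <= 1. *)
Lemma q_coef_form_ge0 alpha sigma tau g : 0 < alpha < 1 ->
    0 <= sigma -> 0 < tau -> is_g_coef 4 alpha sigma tau g ->
  forall N x, 0 <= \sum_(n < N) \sum_(j < n.+1)
    q_coef sigma tau g j * (x (n - j)%N * x n).
Proof.
move=> a01 s0 t0 gE N x.
pose rho := expR (- (sigma * tau)); have rho0 : 0 < rho by exact: expR_gt0.
have rho1 : rho <= 1 by rewrite -expR0 ler_expR oppr_le0 mulr_ge0// ltW.
pose K : R := (25 / 12) `^ alpha; have K0 : 0 < K by rewrite powR_gt0 ?divr_gt0.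
pose h j := g j / (K * rho ^+ j).
have hE : \forall z \near (0 : R), pseries h z @ \oo --> (bdf4 R).[z] `^ alpha.
  have bpos : \forall z \near (0 : R), 0 < (bdf4 R).[z].
    apply: (cvgr_gt _ (@continuous_horner R (bdf4 R) 0)).
    by rewrite horner_coef0 coef0_bdf4.
  have {}gE : \forall z \near (0 : R),
      pseries g (z / rho) @ \oo --> bdf_symbol 4 sigma tau (z / rho) `^ alpha.
    move/nbhs_ballP: gE => [r /= r0 Hr]; apply/nbhs_ballP.
    exists (r * rho) => /=; first exact: mulr_gt0.
    move=> z; rewrite /ball /= sub0r normrN => zr; apply: Hr.
    by rewrite /ball /= sub0r normrN normrM normfV (gtr0_norm rho0) ltr_pdivrMr.
  near=> z.
  have bz : 0 < (bdf4 R).[z] by near: z.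
  have : pseries g (z / rho) @ \oo --> K * (bdf4 R).[z] `^ alpha.
    rewrite -powRM ?divr_ge0 ?ltW//.
    have -> : 25 / 12 * (bdf4 R).[z] = bdf_symbol 4 sigma tau (z / rho).
      by rewrite bdf_symbol4E -/rho mulrCA mulfV ?gt_eqF// mulr1.
    by near: z.
  move=> /(cvgM (cvg_cst K^-1)); rewrite mulKf ?gt_eqF//.
  apply: cvg_trans; apply: near_eq_cvg; apply: nearW => n.
  rewrite /pseries /series /= mulr_sumr; apply: eq_bigr => i _.
  by rewrite /h invfM exprMn exprVn; ring.
pose qt j := \sum_(m < j.+1) (2 ^+ m)^-1 * h (j - m)%N.
have qE j : q_coef sigma tau g j = K * rho ^+ j * qt j.
  rewrite /q_coef big_mkord mulr_sumr; apply: eq_bigr => m _.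
  have -> : expR (- (sigma * m%:R * tau)) = rho ^+ m.
    by rewrite -expRM_natl; congr expR; ring.
  have mj : (m <= j)%N by rewrite -ltnS.
  rewrite /h; have -> : rho ^+ j = rho ^+ m * rho ^+ (j - m).
    by rewrite -exprD subnKC.
  by field; rewrite !expf_neq0 ?gt_eqF.
pose u n := x n / rho ^+ n.
have xE n : x n = rho ^+ n * u n.
  by rewrite /u mulrCA divff ?mulr1// expf_neq0 ?gt_eqF.
have -> : \sum_(n < N) \sum_(j < n.+1)
    q_coef sigma tau g j * (x (n - j)%N * x n)
  = K * \sum_(n < N) rho ^+ (n + n) *
      \sum_(j < n.+1) qt j * (u (n - j)%N * u n).
  rewrite mulr_sumr; apply: eq_bigr => n _; rewrite !mulr_sumr.
  apply: eq_bigr => j _; rewrite qE !xE exprD.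
  have -> : rho ^+ n = rho ^+ j * rho ^+ (n - j).
    by rewrite -exprD subnKC// -ltnS.
  by ring.
rewrite mulr_ge0 ?(ltW K0)//.
apply: (@abel_summation_ge0 R (fun n => rho ^+ (n + n))
  (fun n => \sum_(j < n.+1) qt j * (u (n - j)%N * u n)) N
  (fun n => exprn_ge0 _ (ltW rho0)) _ _) => n.
  by apply: ler_wiXn2l; [exact: ltW | | lia].
exact: bdf4_power_form_ge0 a01 hE n u.
Unshelve. all: by end_near. Qed.

End Scalar.

(** * Gram matrices as positive kernels *)

Section Gram.
Variable R : realType.

Lemma dot_ge0 (K : numFieldType) (theta : K -> K) (H : lmodType K)
  (dot : {dot H for theta}) (u : H) : 0 <= dot u u.
Proof.
have [->|u0] := eqVneq u 0; first by rewrite linear0l.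
exact/ltW/neq0_dnorm_gt0.
Qed.

Lemma positive_kernel_gram (H : lmodType R) (dot : {dot H for idfun}) N
  (v : nat -> H) : positive_kernel N (fun i j => dot (v i) (v j)).
Proof.
move=> x; have := dot_ge0 dot (\sum_(i < N) x i *: v i).
rewrite linear_sumlz; congr (0 <= _); apply: eq_bigr => i _.
rewrite linear_sumr; apply: eq_bigr => j _.
by rewrite linearZl_LR linearZr_LR /=; ring.
Qed.

(** On real combinations of the vectors, the squared norm is the quadratic form of the real parts of
    the Gram matrix. *)
Lemma positive_kernel_Re_gram (H : lmodType R[i]) (dot : {dot H for Num.conj})
    N (v : nat -> H) :
  positive_kernel N (fun i j => complex.Re (dot (v i) (v j))).
Proof.
move=> x; have := dot_ge0 dot (\sum_(i < N) (x i)%:C%C *: v i).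
rewrite lecE /= => /andP[_].
rewrite linear_sumlz raddf_sum; congr (0 <= _); apply: eq_bigr => i _.
rewrite linear_sumr raddf_sum; apply: eq_bigr => j _.
rewrite linearZl_LR linearZr_LR /=; case: (dot _ _) => a b.
rewrite [_^*]/(conjc _) /=.
ring.
Qed.

End Gram.

(** * The inequality in real and complex Hilbert spaces *)

Theorem lemma3p6 (R : realType) (alpha sigma tau : R)
    (alpha_gt0 : 0 < alpha) (alpha_lt1 : alpha < 1)
    (sigma_ge0 : 0 <= sigma) (tau_gt0 : 0 < tau)
    (g : R^nat) (gE : is_g_coef 4 alpha sigma tau g) :
  (forall (H : completeNormedModType R) (dot : {dot H for idfun}),
     dot_induces_norm dot ->
     forall (N : nat) (v : nat -> H), (0 < N)%N ->
     0 <= \sum_(1 <= n < N.+1)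
            dot (\sum_(0 <= j < n) q_coef sigma tau g j *: v (n - j)%N) (v n))
  /\
  (forall (H : completeNormedModType R[i]) (dot : {dot H for Num.conj}),
     dot_induces_norm dot ->
     forall (N : nat) (v : nat -> H), (0 < N)%N ->
     0 <= complex.Re (\sum_(1 <= n < N.+1)
            dot (\sum_(0 <= j < n) (q_coef sigma tau g j)%:C%C *: v (n - j)%N)
                (v n))).
Proof.
have a01 : 0 < alpha < 1 by rewrite alpha_gt0.
have qP := q_coef_form_ge0 a01 sigma_ge0 tau_gt0 gE.
split=> H dot _ N v _.
  (* Vectors are numbered from 1 and kernels from 0, whence the successors. *)
  have Gsym i j : dot (v i.+1) (v j.+1) = dot (v j.+1) (v i.+1).
    by rewrite hermC expr0 mul1r.
  have := convolution_pairing (qP N) Gsym (positive_kernel_gram dot _ _).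
  congr (0 <= _); rewrite big_add1 big_mkord; apply: eq_bigr => n _.
  rewrite big_mkord linear_sumlz; apply: eq_bigr => j _.
  by rewrite linearZl_LR /= subSn// -ltnS.
have ReJ (z : R[i]) : complex.Re (Num.conj z) = complex.Re z by case: z.
have ReZ (a : R) (z : R[i]) : complex.Re (a%:C%C * z) = a * complex.Re z.
  by case: z => b c /=; rewrite mul0r subr0.
have Gsym i j : complex.Re (dot (v i.+1) (v j.+1))
    = complex.Re (dot (v j.+1) (v i.+1)).
  by rewrite hermC expr0 mul1r; exact: ReJ.
have := convolution_pairing (qP N) Gsym (positive_kernel_Re_gram dot _ _).
congr (0 <= _); rewrite big_add1 big_mkord raddf_sum; apply: eq_bigr => n _.
rewrite big_mkord linear_sumlz raddf_sum; apply: eq_bigr => j _.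
rewrite linearZl_LR subSn; last by rewrite -ltnS.
exact/esym/ReZ.
Qed.
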